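(* For all integers $1\le t\le r$ there exists an integer $n_0=n_0(r,t)$ such that the following holds for all integers $k\ge 2$ and $r\le n_1\le n_2\le\cdots\le n_k$ with $n_2\ge n_0$. Let $\mathscr{F}\subseteq\mathcal{K}_r(n_1,\ldots,n_k)$ be a $t$-intersecting family. Then \[ |\mathscr{F}|\le\frac{(n_1-t)_{r-t}\cdots(n_k-t)_{r-t}}{(r-t)!}. \] Furthermore, equality is attained if and only if $\mathscr{F}$ is a $t$-star of $\mathcal{K}_r(n_1,\ldots,n_k)$.
   Context: For a positive integer $n$, $[n]=\{1,\ldots,n\}$. For non-negative integers $b\le a$, $(a)_b=\frac{a!}{(a-b)!}$. $\mathcal{K}(n_1,\ldots,n_k)$ denotes the complete $k$-partite $k$-graph with parts $[n_1],\ldots,[n_k]$ (regarded as disjoint); its edges are identified with the $k$-tuples $(x_1,\ldots,x_k)\in[n_1]\times\cdots\times[n_k]$. An $r$-matching is a set of $r$ pairwise vertex-disjoint edges, i.e. a set of $r$ such $k$-tuples any two of which differ in every coordinate. $\mathcal{K}_r(n_1,\ldots,n_k)$ is the set of all $r$-matchings of $\mathcal{K}(n_1,\ldots,n_k)$. A family $\mathscr{F}\subseteq\mathcal{K}_r(n_1,\ldots,n_k)$ is $t$-intersecting if any two members of $\mathscr{F}$ share at least $t$ edges. A $t$-star of $\mathcal{K}_r(n_1,\ldots,n_k)$ is a family of the form $\{M\in\mathcal{K}_r(n_1,\ldots,n_k): C\subseteq M\}$ for some $t$-matching $C\in\mathcal{K}_t(n_1,\ldots,n_k)$. *)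

(* Defs.v *)
From mathcomp Require Import all_boot all_order all_algebra.

Set Implicit Arguments.
Unset Strict Implicit.
Unset Printing Implicit Defensive.

(* An edge of K(n_1, ..., n_k) is the tuple of its vertices.  Indices and
   vertices are 0-based: n i is n_(i+1), and 'I_(n i) stands for [n_(i+1)]. *)
Notation edge n := {dffun forall i, 'I_(n i)}.

Definition disjoint_edges (k : nat) (n : 'I_k -> nat) (x y : edge n) : bool :=
  [forall i, x i != y i].

Definition is_matching (k : nat) (n : 'I_k -> nat) (M : {set edge n}) : bool :=
  [forall x in M, forall y in M, (x != y) ==> disjoint_edges x y].

Definition matchings (k : nat) (n : 'I_k -> nat) (r : nat) :
    {set {set edge n}} :=
  [set M : {set edge n} | is_matching M & #|M| == r].

Definition t_intersecting (k : nat) (n : 'I_k -> nat) (t : nat)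
    (F : {set {set edge n}}) : Prop :=
  {in F &, forall M N, t <= #|M :&: N|}.

Definition t_star (k : nat) (n : 'I_k -> nat) (r t : nat)
    (F : {set {set edge n}}) : Prop :=
  exists2 C : {set edge n}, C \in matchings n t
    & F = [set M in matchings n r | C \subset M].

(* Main.v *)
(* A t-intersecting family F that lies in no t-star is small.  Fix A in F; every
   member of F contains some t-subset T of A.  Since F is not contained in the
   star of T, some B_T in F does not contain T, and every M in F containing T
   must meet B_T outside T.  Hence the members of F are covered by the stars of
   at most 'C(r, t) * r sets of size t + 1, whereas a t-star is larger than such
   a star by the factor (n_1 - t) ... (n_k - t) / (r - t) >= n_2 - t. *)
Require Import Defs.
From mathcomp Require Import all_boot all_order all_algebra.

Set Implicit Arguments.
Unset Strict Implicit.
Unset Printing Implicit Defensive.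
Import Order.TTheory GRing.Theory Num.Theory.

Section Stars.

Variables (k : nat) (n : 'I_k -> nat).
Implicit Types (x y : edge n) (C M S T A : {set edge n}) (F : {set {set edge n}}).

Definition star (r : nat) C : {set {set edge n}} :=
  [set M in matchings n r | C \subset M].

Definition free_edges C : {set edge n} :=
  [set x | [forall y in C, disjoint_edges y x]].

Lemma is_matchingP M :
  reflect {in M &, forall x y, x != y -> forall i, x i != y i} (is_matching M).
Proof.
apply: (iffP forall_inP) => [mM x y xM yM xy i | mM x xM].
  by have /forall_inP/(_ y yM)/implyP/(_ xy)/forallP := mM x xM.
by apply/forall_inP => y yM; apply/implyP => xy; apply/forallP => i; apply: mM.
Qed.

Lemma is_matchingS C M : C \subset M -> is_matching M -> is_matching C.
Proof.
move=> /subsetP sCM /is_matchingP mM; apply/is_matchingP => x y /sCM xM /sCM yM.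
exact: mM.
Qed.

Lemma free_edgesP C x :
  reflect {in C, forall y i, y i != x i} (x \in free_edges C).
Proof.
rewrite inE; apply: (iffP forall_inP) => [h y /h/forallP // | h y yC].
by apply/forallP => i; apply: h.
Qed.

(** Projecting a matching to a coordinate is injective, so [C] occupies exactly [#|C|] vertices of
    every part; a free edge chooses each coordinate independently outside the occupied set [V i]. *)
Lemma card_free_edges C :
  is_matching C -> #|free_edges C| = \prod_(i < k) (n i - #|C|).
Proof.
move=> /is_matchingP mC.
pose V i := [set (x : edge n) i | x in C].
have -> : #|free_edges C| = #|(family (fun i => mem (~: V i)) : simpl_pred (edge n))|.
  apply: eq_card => x; apply/free_edgesP/familyP => [xC i | xC y yC i].
    rewrite inE; apply/negP => /imsetP[y yC eq_xy].
    by have := xC y yC i; rewrite eq_xy eqxx.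
  have := xC i; rewrite inE; apply: contraNneq => <-.
  exact: (imset_f (fun z : edge n => z i)).
rewrite card_family foldrE big_image /=; apply: eq_bigr => i _.
rewrite cardsCs card_ord setCK card_in_imset // => x y xC yC /= eq_xy.
by apply/eqP/negPn/negP => /(mC x y xC yC)/(_ i)/eqP.
Qed.

Lemma is_matchingU1 C x :
  is_matching C -> x \in free_edges C -> is_matching (x |: C).
Proof.
move=> /is_matchingP mC /free_edgesP xC; apply/is_matchingP => y z.
case/setU1P=> [->|yC] /setU1P[->|zC] ne i; first by rewrite eqxx in ne.
- by rewrite eq_sym xC.
- exact: xC.
- exact: mC.
Qed.

(** With at least one coordinate no edge is disjoint from itself, so free edges of [C] lie outside
    [C]. *)
Lemma mem_starU1 (r : nat) C M x : 0 < k -> M \in star r C ->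
  (x \in M :\: C) = (x \in free_edges C) && (M \in star r (x |: C)).
Proof.
move=> k_gt0; rewrite !inE subUset sub1set => /andP[Mr sCM]; rewrite Mr sCM andbT.
have /is_matchingP mM : is_matching M by case/andP: Mr.
apply/andP/andP => [[xC xM] | [/forall_inP xC xM]]; split=> //.
  apply/forall_inP => y yC; apply/forallP => i; apply: mM => //.
    exact: (subsetP sCM).
  by apply: contraNneq xC => <-.
by apply/negP => /xC/forallP/(_ (Ordinal k_gt0)); rewrite eqxx.
Qed.

Lemma starS (r : nat) C S : C \subset S -> star r S \subset star r C.
Proof.
move=> sCS; apply/subsetP => M; rewrite !inE => /andP[-> sSM].
exact: subset_trans sSM.
Qed.

(* Counts the pairs (M, x) with x in M :\: C in two ways. *)
Lemma star_double_count (r : nat) C : 0 < k ->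
  #|star r C| * (r - #|C|) = \sum_(x in free_edges C) #|star r (x |: C)|.
Proof.
move=> k_gt0; rewrite -sum_nat_const.
transitivity (\sum_(M in star r C) #|M :\: C|).
  apply: eq_bigr => M; rewrite !inE => /andP[/andP[_ /eqP <-] sCM].
  by rewrite cardsDS.
under eq_bigr do rewrite -sum1_card.
under [RHS]eq_bigr do rewrite -sum1_card.
rewrite (exchange_big_dep (mem (free_edges C))) /=; last first.
  by move=> M x MC; rewrite (mem_starU1 _ k_gt0 MC) => /andP[].
apply: eq_bigr => x xC; apply: eq_bigl => M.
case: (boolP (M \in star r C)) => [MC|]; first by rewrite (mem_starU1 _ k_gt0 MC) xC.
(* An [M] outside the star of [C] contributes to neither sum, since the star of [x |: C] is
   smaller. *)
move=> MC; apply/esym/negbTE; apply: contra MC; apply/subsetP/starS/subsetUr.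
Qed.

(** Induction on [r - #|C|]. By double counting, the star of [C] is governed by the stars of
    [x |: C], whose sizes are all equal by induction; the number of free edges supplies the leading
    factor of each falling factorial. *)
Lemma card_star (r : nat) C : 0 < k -> is_matching C -> #|C| <= r ->
  #|star r C| * (r - #|C|)`! = \prod_(i < k) (n i - #|C|) ^_ (r - #|C|).
Proof.
move=> k_gt0; move eq_d: (r - #|C|) => d.
elim: d C eq_d => [|d IHd] C eq_d mC leCr.
  have eqCr : #|C| = r by apply/eqP; rewrite eqn_leq leCr -subn_eq0 eq_d.
  rewrite muln1 (eq_bigr (fun=> 1)) => [|i _]; last by rewrite ffactn0.
  rewrite big1_eq; apply/eqP/cards1P; exists C; apply/setP => M; rewrite !inE.
  apply/andP/eqP => [[/andP[_ /eqP cM] sCM] | ->]; last by rewrite mC eqCr eqxx.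
  by apply/esym/eqP; rewrite eqEcard sCM cM eqCr leqnn.
rewrite factS mulnA -eq_d star_double_count // big_distrl /=.
transitivity (\sum_(x in free_edges C) \prod_(i < k) (n i - #|C|.+1) ^_ d).
  apply: eq_bigr => x xC.
  have xNC : x \notin C.
    by apply/negP => xC'; have /free_edgesP/(_ x xC' (Ordinal k_gt0))/eqP := xC.
  have cxC : #|x |: C| = #|C|.+1 by rewrite cardsU1 xNC.
  rewrite -cxC IHd ?is_matchingU1 // cxC; first by rewrite subnS eq_d.
  by rewrite -subn_gt0 eq_d.
rewrite sum_nat_const card_free_edges // -big_split /=.
by apply: eq_bigr => i _; rewrite eq_d ffactnS subnS.
Qed.

(** Here [S] may fail to be a matching, as can happen to the sets [x |: T] of the cover below; its
    star is then empty. *)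
Lemma card_star_le (r : nat) S : 0 < k ->
  #|star r S| * (r - #|S|)`! <= \prod_(i < k) (n i - #|S|) ^_ (r - #|S|).
Proof.
move=> k_gt0; have [-> | [M]] := set_0Vmem (star r S); first by rewrite cards0.
rewrite !inE => /andP[/andP[mM /eqP <-] sSM].
by rewrite card_star // ?subset_leq_card // (is_matchingS sSM).
Qed.

Lemma nontrivial_cover (r t : nat) F A :
    F \subset matchings n r -> t_intersecting t F -> A \in F ->
    (forall T, T \in matchings n t -> ~~ (F \subset star r T)) ->
  exists2 X : {set {set edge n} * edge n}, #|X| <= 'C(r, t) * r
    & {in X, forall Tx, #|Tx.2 |: Tx.1| = t.+1} /\
      F \subset \bigcup_(Tx in X) star r (Tx.2 |: Tx.1).
Proof.
move=> /subsetP sF tF AF nontriv.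
have /[!inE]/andP[mA /eqP cA] := sF A AF.
pose D := [set T : {set edge n} | T \subset A & #|T| == t].
(* The default [set0] is never reached for [T] in [D], as [BP] shows. *)
pose B T := odflt set0 [pick M in F | ~~ (T \subset M)].
have BP T : T \in D -> B T \in F /\ ~~ (T \subset B T).
  rewrite inE => /andP[sTA cT]; rewrite /B; case: pickP => [M /andP[]|noM] //=.
  have: T \in matchings n t by rewrite inE (is_matchingS sTA mA).
  move/nontriv/subsetPn=> [M MF]; rewrite inE sF //= => nTM.
  by have := noM M; rewrite /= MF nTM.
exists [set Tx | (Tx.1 \in D) && (Tx.2 \in B Tx.1 :\: Tx.1)].
  rewrite -sum1_card.
  under eq_bigl do rewrite inE.
  rewrite -(pair_big_dep (mem D) (fun T x => x \in B T :\: T) (fun _ _ => 1)) /=.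
  rewrite -cA -cards_draws -/D cA -sum_nat_const; apply: leq_sum => T TD.
  rewrite sum1_card; have [/sF] := BP T TD.
  by rewrite inE => /andP[_ /eqP <-] _; apply/subset_leq_card/subsetDl.
split=> [[T x]|].
  by rewrite !inE /= => /and3P[/andP[_ /eqP cT] xNT _]; rewrite cardsU1 xNT cT.
apply/subsetP => M MF.
(* [A :&: M] may have more than [t] edges; exactly [t] of them are selected to form [T]. *)
have /card_geqP[s [uniq_s size_s /subsetP sM]] := tF A M AF MF.
pose T := [set x in s].
have sTAM : T \subset A :&: M by apply/subsetP => x; rewrite inE => /(subsetP sM).
have /andP[sTA sTM] : (T \subset A) && (T \subset M) by rewrite -subsetI.
have cT : #|T| = t by rewrite cardsE (card_uniqP uniq_s).
have TD : T \in D by rewrite inE sTA cT eqxx.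
have [BF nTB] := BP T TD.
(* Otherwise [M :&: B T], having at least [t] edges inside the [t]-set [T], would equal [T], putting
   [T] inside [B T]. *)
have /subsetPn[x] : ~~ (M :&: B T \subset T).
  apply: contra nTB => sT.
  have /eqP eqT : M :&: B T == T by rewrite eqEcard sT cT tF.
  by rewrite -{1}eqT subsetIr.
rewrite inE => /andP[xM xB] xNT.
apply/bigcupP; exists (T, x); first by rewrite inE TD inE xNT.
by rewrite inE sF //= subUset sub1set xM.
Qed.

Lemma card_nontrivial (r t : nat) F : 0 < k ->
    F \subset matchings n r -> t_intersecting t F ->
    (forall T, T \in matchings n t -> ~~ (F \subset star r T)) ->
  #|F| * (r - t.+1)`! <=
    'C(r, t) * r * \prod_(i < k) (n i - t.+1) ^_ (r - t.+1).
Proof.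
move=> k_gt0 sF tF nontriv.
have [-> | [A AF]] := set_0Vmem F; first by rewrite cards0.
have [X leX [cX sX]] := nontrivial_cover sF tF AF nontriv.
apply: leq_trans (leq_mul leX (leqnn _)).
have {sX} : #|F| <= \sum_(Tx in X) #|star r (Tx.2 |: Tx.1)|.
  apply: leq_trans (subset_leq_card sX) _.
  elim/big_rec2: _ => [|Tx m U _ le_m]; first by rewrite cards0.
  by rewrite (leq_trans (leq_card_setU _ _)) ?leq_add2l.
rewrite -(leq_pmul2r (fact_gt0 (r - t.+1))) => /leq_trans; apply.
rewrite -sum_nat_const big_distrl leq_sum // => Tx TxX; rewrite -(cX Tx TxX).
exact: card_star_le.
Qed.

End Stars.

Lemma nontrivial_lt (r t k : nat) (hk : 1 < k) (n : 'I_k -> nat)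
    (F : {set {set edge n}}) :
    t <= r -> (forall i, r <= n i) -> 'C(r, t) * r + t < n (Ordinal hk) ->
    F \subset matchings n r -> t_intersecting t F ->
    (forall T, T \in matchings n t -> ~~ (F \subset star r T)) ->
  #|F| * (r - t)`! < \prod_(i < k) (n i - t) ^_ (r - t).
Proof.
(* The case [t = r] is separate because no factor can be split off an empty falling factorial. All
   members of [F] then coincide, so a nonempty [F] would lie in a star. *)
rewrite leq_eqVlt => /predU1P[<- _ _ /subsetP sF tF nontriv |].
  have [-> | [A AF]] := set_0Vmem F.
    by rewrite cards0 prodn_gt0 // => i; rewrite subnn ffactn0.
  have /negP[] := nontriv A (sF A AF); apply/subsetP => M MF.
  have /[!inE]/andP[_ /eqP cA] := sF A AF.
  have /[!inE] -> /= := sF M MF.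
  have /eqP <- : A :&: M == A by rewrite eqEcard subsetIl cA tF.
  exact: subsetIr.
move=> ltr le_rn lt_n2 sF tF nontriv.
have subSt : r - t = (r - t.+1).+1 by rewrite subnSK.
have -> : \prod_(i < k) (n i - t) ^_ (r - t) =
    \prod_(i < k) (n i - t) * \prod_(i < k) (n i - t.+1) ^_ (r - t.+1).
  by rewrite -big_split; apply: eq_bigr => i _; rewrite subSt ffactnS (subnS (n i)).
have Q_gt0 : 0 < \prod_(i < k) (n i - t.+1) ^_ (r - t.+1).
  by rewrite prodn_gt0 // => i; rewrite ffact_gt0 leq_sub2r ?le_rn.
have {}subSt : (r - t)`! = (r - t) * (r - t.+1)`! by rewrite subSt factS.
have := card_nontrivial (ltnW hk) sF tF nontriv.
rewrite -(leq_pmul2l (m := r - t)) ?subn_gt0 // mulnCA -subSt.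
move=> /leq_ltn_trans; apply.
rewrite mulnA ltn_pmul2r //.
have ne01 : Ordinal (ltnW hk) != Ordinal hk by [].
rewrite (bigD1 (Ordinal (ltnW hk))) //= (bigD1 (Ordinal hk)) //=.
rewrite [X in _ < X]mulnA.
have lt_main : (r - t) * ('C(r, t) * r) <
    (n (Ordinal (ltnW hk)) - t) * (n (Ordinal hk) - t).
  (* The factor of the first part absorbs [r - t], since it has at least [r] vertices; the second
     part is large enough to beat ['C(r, t) * r] strictly. *)
  apply: (@leq_trans ((r - t) * (n (Ordinal hk) - t))).
    by rewrite ltn_pmul2l ?subn_gt0 // ltn_subRL addnC.
  by rewrite leq_mul2r leq_sub2r ?le_rn ?orbT.
apply: (leq_trans lt_main); rewrite leq_pmulr // prodn_cond_gt0 // => i _.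
by rewrite subn_gt0 (leq_trans ltr).
Qed.

Theorem theorem3p3 (r t : nat) (ht : 1 <= t) (htr : t <= r) :
  exists n0 : nat,
    forall (k : nat) (hk : 1 < k) (n : 'I_k -> nat),
      (forall i, r <= n i) ->
      (forall i j : 'I_k, i <= j -> n i <= n j) ->
      n0 <= n (Ordinal hk) ->
      forall F : {set {set edge n}},
        F \subset matchings n r ->
        t_intersecting t F ->
        let bound : rat :=
          ((\prod_(i < k) (n i - t) ^_ (r - t))%:R / ((r - t)`!)%:R)%R in
        (#|F|%:R <= bound)%R /\ (#|F|%:R = bound <-> t_star r t F)%R.
Proof.
(* This threshold says exactly that [n_2 - t] exceeds ['C(r, t) * r], the size bound of the
   cover. *)
exists ('C(r, t) * r + t).+1 => k hk n le_rn _ lt_n2 F sF tF /=.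
set B := \prod_(i < k) _; have k_gt0 := ltnW hk.
have fact_gt0R : (0 < ((r - t)`!)%:R :> rat)%R by rewrite ltr0n fact_gt0.
rewrite ler_pdivlMr // -natrM ler_nat.
have eq_bound : (#|F|%:R = B%:R / ((r - t)`!)%:R :> rat)%R <-> #|F| * (r - t)`! = B.
  have f_neq0 := lt0r_neq0 fact_gt0R.
  split=> [eqF | <-]; last by rewrite natrM mulfK.
  by apply/eqP; rewrite -(eqr_nat rat) natrM eqF divfK.
have cstar T : T \in matchings n t -> #|star r T| * (r - t)`! = B.
  by rewrite inE => /andP[mT /eqP cT]; rewrite /B -cT card_star // cT.
have star_bound : t_star r t F -> #|F| * (r - t)`! = B.
  by case=> T Tt ->; apply: cstar.
(* Inside a star the bound is monotonicity, and equal cardinality forces [F] to be the whole star.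
   Outside all stars the bound is strict, which excludes both sides of the equivalence. *)
have [/exists_inP[T Tt sFT] | triv] :=
    boolP [exists T in matchings n t, F \subset star r T].
  split; first by rewrite -(cstar T Tt) leq_pmul2r ?fact_gt0 // subset_leq_card.
  split=> [/eq_bound eqF | /star_bound/eq_bound //]; exists T => //; apply/eqP.
  rewrite eqEcard sFT /= -(leq_pmul2r (fact_gt0 (r - t))) eqF.
  by rewrite (cstar T Tt).
have nontriv T : T \in matchings n t -> ~~ (F \subset star r T).
  by move=> Tt; apply: contra triv => sFT; apply/exists_inP; exists T.
have ltF := nontrivial_lt htr le_rn lt_n2 sF tF nontriv.
split; first exact: ltnW.
by split=> [/eq_bound | /star_bound] eqF; move: ltF; rewrite eqF ltnn.
Qed.
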